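(* For all integers $k,\ell\ge 3$: (i) $\gamma_{gr}^{t}(C_k\,\square\,C_\ell)\le k\ell-\min\{k,\ell\}$; (ii) $\gamma_{gr}^{t}(P_k\,\square\,P_\ell)\le k\ell-\min\{\lfloor k/2\rfloor,\lfloor \ell/2\rfloor\}$; (iii) $\gamma_{gr}^{t}(P_k\,\square\,C_\ell)\le k\ell-\min\{k,\lceil \ell/2\rceil\}$.
   Context: $P_n$ and $C_n$ denote the path and the cycle on $n$ vertices. $N(v)$ denotes the open neighborhood of $v$. A sequence $(v_1,\ldots,v_m)$ of distinct vertices of a graph $G$ is a (legal) open neighborhood sequence if $N(v_i)\setminus\bigcup_{j=1}^{i-1}N(v_j)\neq\emptyset$ for each $i$. The Grundy total domination number $\gamma_{gr}^{t}(G)$ is the maximum length of a legal open neighborhood sequence of $G$. The Cartesian product $G\,\square\,H$ has vertex set $V(G)\times V(H)$, and $(g_1,h_1)$, $(g_2,h_2)$ are adjacent iff $g_1g_2\in E(G)$ and $h_1=h_2$, or $g_1=g_2$ and $h_1h_2\in E(H)$. *)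

(* Defs.v *)
(* MathComp.  A (finite simple) graph is a symmetric irreflexive [e : rel T]
   on a finType [T]. *)
From mathcomp Require Import all_boot.

Set Implicit Arguments.
Unset Strict Implicit.
Unset Printing Implicit Defensive.

Definition path_graph (n : nat) : rel 'I_n :=
  fun i j => (i.+1 == j :> nat) || (j.+1 == i :> nat).

(* This is C_n for n >= 3; it degenerates to a loop for n = 1 and to K_2 for
   n = 2. *)
Definition cycle_graph (n : nat) : rel 'I_n :=
  fun i j => (i.+1 %% n == j :> nat) || (j.+1 %% n == i :> nat).

Definition cartesian_product (T U : finType) (e : rel T) (f : rel U) :
    rel (T * U) :=
  fun x y => (e x.1 y.1 && (x.2 == y.2)) || ((x.1 == y.1) && f x.2 y.2).

Definition open_nbhd (T : finType) (e : rel T) (v : T) : {set T} :=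
  [set w | e v w].

Definition legal_open_nbhd_seq (T : finType) (e : rel T) (m : nat)
    (s : m.-tuple T) : bool :=
  uniq s &&
  [forall i : 'I_m,
     open_nbhd e (tnth s i) :\: \bigcup_(j < m | j < i) open_nbhd e (tnth s j)
       != set0].

(* Lengths are bounded by #|T| because the vertices of a sequence are distinct;
   see [grundy_total_domination_max] and [grundy_total_domination_attained]. *)
Definition grundy_total_domination (T : finType) (e : rel T) : nat :=
  \max_(m < #|T|.+1 | [exists s : m.-tuple T, legal_open_nbhd_seq e s]) m.

Lemma path_graph_sym n : symmetric (@path_graph n).
Proof. by move=> i j; rewrite /path_graph orbC. Qed.

Lemma path_graph_irrefl n : irreflexive (@path_graph n).
Proof. by move=> i; rewrite /path_graph orbb gtn_eqF. Qed.

Lemma cycle_graph_sym n : symmetric (@cycle_graph n).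
Proof. by move=> i j; rewrite /cycle_graph orbC. Qed.

Lemma cycle_graph_irrefl n : 1 < n -> irreflexive (@cycle_graph n).
Proof.
move=> n_gt1 i; rewrite /cycle_graph orbb; apply/negbTE.
have := ltn_ord i; rewrite leq_eqVlt => /predU1P[Ei | lt_i1n].
  rewrite {1}Ei modnn eq_sym -lt0n.
  by rewrite -ltnS Ei.
by rewrite modn_small // gtn_eqF.
Qed.

Lemma cartesian_product_sym (T U : finType) (e : rel T) (f : rel U) :
  symmetric e -> symmetric f -> symmetric (cartesian_product e f).
Proof.
by move=> se sf x y; rewrite /cartesian_product se sf (eq_sym x.1) (eq_sym x.2).
Qed.

Lemma cartesian_product_irrefl (T U : finType) (e : rel T) (f : rel U) :
  irreflexive e -> irreflexive f -> irreflexive (cartesian_product e f).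
Proof. by move=> ie jf x; rewrite /cartesian_product ie jf andbF. Qed.

Lemma grundy_total_domination_max (T : finType) (e : rel T) m
    (s : m.-tuple T) :
  legal_open_nbhd_seq e s -> m <= grundy_total_domination e.
Proof.
move=> leg; have lt_m : m < #|T|.+1.
  by case/andP: leg => /card_uniqP Es _; rewrite ltnS -[m](size_tuple s) -Es max_card.
apply: (@leq_bigmax_cond _ _ (fun i : 'I_#|T|.+1 => i : nat) (Ordinal lt_m)).
by apply/existsP; exists s.
Qed.

Lemma grundy_total_domination_attained (T : finType) (e : rel T) :
  exists s : (grundy_total_domination e).-tuple T, legal_open_nbhd_seq e s.
Proof.
pose P (i : 'I_#|T|.+1) := [exists s : i.-tuple T, legal_open_nbhd_seq e s].
have P0 : P ord0.
  by apply/existsP; exists [tuple]; apply/andP; split=> //; apply/forallP; case.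
rewrite /grundy_total_domination (bigmax_eq_arg _ P0).
by case: arg_maxnP => // i /existsP.
Qed.

(* Main.v *)
(* Reading a legal sequence backwards, its footprinted vertices form a growing
   set [W] along which |N(W)| - |W| never exceeds n minus the length of the
   sequence.  So it is enough to find, at one moment of the growth, a set [W]
   with |N(W)| - |W| at least the required d; this excess is a sum over the
   rows, or over the columns.  On a cycle the excess of a set is nonnegative,
   and positive if [N] is nonempty and the set contains no orbit of the shift
   by 2; on a path it is nonnegative as soon as [N] misses a vertex [z], by
   shifting the set towards [z].  The moment is when a row or a column first
   contains such an orbit (torus), when a row does (cylinder), or when [N]
   first meets all rows or all columns (grid). *)
Require Import Defs.
From mathcomp Require Import all_boot zify.

Set Implicit Arguments.
Unset Strict Implicit.
Unset Printing Implicit Defensive.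

(** * Neighbourhoods of vertex sets and the threshold argument *)

Definition nbhd (T : finType) (e : rel T) (W : {set T}) : {set T} :=
  [set v | [exists w in W, e v w]].

Lemma nbhdP (T : finType) (e : rel T) (W : {set T}) v :
  reflect (exists2 w, w \in W & e v w) (v \in nbhd e W).
Proof. by rewrite inE; apply: exists_inP. Qed.

Lemma mem_nbhd (T : finType) (e : rel T) (W : {set T}) v w :
  w \in W -> e v w -> v \in nbhd e W.
Proof. by move=> Ww vw; apply/nbhdP; exists w. Qed.

Lemma nbhdS (T : finType) (e : rel T) (A B : {set T}) :
  A \subset B -> nbhd e A \subset nbhd e B.
Proof.
move=> /subsetP AB; apply/subsetP=> v /nbhdP[w Aw vw].
exact: mem_nbhd (AB _ Aw) vw.
Qed.

Lemma nbhd0 (T : finType) (e : rel T) : nbhd e set0 = set0.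
Proof.
by apply/setP=> v; rewrite [RHS]inE; apply/nbhdP=> -[w]; rewrite inE.
Qed.

(* The sets [W] are the final segments of a sequence of footprinted vertices:
   the vertices that come before such a segment avoid [nbhd e W]. *)
Lemma legal_threshold (T : finType) (e : rel T) m (s : m.-tuple T)
    (P : pred {set T}) :
  legal_open_nbhd_seq e s -> ~~ P set0 ->
  (forall W : {set T}, #|W| = m -> P W) ->
  exists W : {set T}, exists x,
    [/\ x \notin W, ~~ P W, P (x |: W),
        #|nbhd e W| + m <= #|T| + #|W|
      & #|nbhd e (x |: W)| + m <= #|T| + #|W|.+1].
Proof.
case/andP=> /tuple_uniqP s_inj /forallP leg P0 Pm.
(* [w i] is footprinted by term [i]: adjacent to it and to no earlier term. *)
have [w w_in w_new] : exists2 w : 'I_m -> T, forall i, e (tnth s i) (w i)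
    & forall i j : 'I_m, j < i -> ~~ e (tnth s j) (w i).
  have /fin_all_exists[w Hw] : forall i, exists x,
      x \in open_nbhd e (tnth s i)
        :\: \bigcup_(j < m | j < i) open_nbhd e (tnth s j).
    by move=> i; apply/set0Pn.
  exists w => [i|i j ltji]; have := Hw i; rewrite !inE => /andP[new //].
  move=> _; apply: contra new => ej; apply/bigcupP; exists j => //.
  by rewrite inE.
have w_inj : injective w.
  move=> i j wij; apply: val_inj.
  by case: (ltngtP i j) => // /w_new; [rewrite -wij | rewrite wij];
    rewrite w_in.
pose tail t := [set w i | i in [set i : 'I_m | t <= i]].
have card_tail t : #|tail t| + #|[set i : 'I_m | i < t]| = m.
  rewrite card_imset // -[RHS]card_ord -(cardsC [set i : 'I_m | t <= i]).
  by congr (_ + #|pred_of_set _|); apply/setP=> i; rewrite !inE -ltnNge.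
have nbhd_tail t : #|nbhd e (tail t)| + m <= #|T| + #|tail t|.
  rewrite -{1}(card_tail t) addnCA [X in _ <= X]addnC leq_add2l.
  rewrite -(card_imset _ s_inj) -(cardsC (nbhd e (tail t))) leq_add2l.
  apply: subset_leq_card.
  apply/subsetP=> _ /imsetP[j lt_j ->]; rewrite !inE in lt_j *.
  apply/exists_inP=> -[_ /imsetP[i le_i ->]]; rewrite inE in le_i.
  by apply/negP/w_new; apply: leq_trans le_i.
have tail_out t : m <= t -> tail t = set0.
  move=> le_mt; apply/setP=> x; rewrite inE; apply/negbTE/imsetP=> -[i].
  by rewrite inE leqNgt (leq_trans (ltn_ord i)).
have ex_t : exists t, ~~ P (tail t) by exists m; rewrite tail_out.
(* The tails shrink from [m] vertices to none; take the first at which [P] fails. *)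
case: (ex_minnP ex_t) => -[|t] nPt min_t.
  case/negP: nPt; apply: Pm; rewrite -[RHS](card_tail 0).
  rewrite [X in _ + X]eq_card0 ?addn0 //.
  by move=> i; rewrite inE.
have Pt : P (tail t).
  by apply/negPn/negP=> /min_t; rewrite ltnn.
have lt_tm : t < m.
  by rewrite ltnNge; apply: contra P0 => /tail_out <-.
pose x := w (Ordinal lt_tm).
have x_new : x \notin tail t.+1.
  apply/imsetP=> -[i]; rewrite inE => lt_ti /w_inj Ei.
  by rewrite -Ei ltnn in lt_ti.
have tailS : tail t = x |: tail t.+1.
  rewrite /tail /x -imsetU1; congr (_ @: pred_of_set _).
  by apply/setP=> i; rewrite !inE leq_eqVlt -val_eqE eq_sym.
exists (tail t.+1), x; split=> //; first by rewrite -tailS.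
by have := nbhd_tail t; rewrite tailS cardsU1 x_new.
Qed.

(** A sequence longer than [n - d] would, by [legal_threshold], keep the excess below [d] both just
    before and just after [P] becomes true. *)
Lemma grundy_total_domination_le (T : finType) (e : rel T) n d
    (P : pred {set T}) :
  #|T| = n -> ~~ P set0 ->
  (forall W : {set T}, n < #|W| + d -> P W) ->
  (forall (W : {set T}) x, x \notin W -> ~~ P W -> P (x |: W) ->
     #|W| + d <= #|nbhd e W| \/ #|x |: W| + d <= #|nbhd e (x |: W)|) ->
  grundy_total_domination e <= n - d.
Proof.
move=> cT P0 Pbig Pstep; rewrite leqNgt; apply/negP=> lt_d.
have [s leg] := grundy_total_domination_attained e.
have := legal_threshold leg P0; case=> [W cW|W [x [nx nPW PxW leW lexW]]].
  by apply: Pbig; lia.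
by have := Pstep W x nx nPW PxW; rewrite cardsU1 nx; lia.
Qed.

(** * Rows and columns of a set in a product *)

(** Convention: the slices of [W] are its rows, those of [transpose W] its columns. *)
Definition slice (T U : finType) (W : {set T * U}) (i : T) : {set U} :=
  [set j | (i, j) \in W].

Definition transpose (T U : finType) (W : {set T * U}) : {set U * T} :=
  [set p | (p.2, p.1) \in W].

Section Slices.
Variables T U : finType.
Implicit Types (W N : {set T * U}) (e : rel T) (f : rel U).

Lemma transposeK : cancel (@transpose T U) (@transpose U T).
Proof. by move=> W; apply/setP=> -[i j]; rewrite !inE. Qed.

Lemma transpose0 : transpose (set0 : {set T * U}) = set0.
Proof. by apply/setP=> p; rewrite !inE. Qed.

Lemma transposeU1 W x : transpose (x |: W) = (x.2, x.1) |: transpose W.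
Proof.
by case: x => a b; apply/setP=> -[j i]; rewrite !inE /= !xpair_eqE andbC.
Qed.

Lemma mem_transpose W i j : ((j, i) \in transpose W) = ((i, j) \in W).
Proof. by rewrite inE. Qed.

Lemma card_slices W : #|W| = \sum_i #|slice W i|.
Proof.
rewrite -sum1_card (eq_bigr (fun i => \sum_(j in slice W i) 1)); last first.
  by move=> i _; rewrite sum1_card.
by rewrite pair_big_dep /=; apply: eq_bigl => -[i j]; rewrite inE.
Qed.

Lemma card_transpose W : #|transpose W| = #|W|.
Proof.
rewrite -(card_imset (transpose W) (f := fun p => (p.2, p.1))); last first.
  by move=> [a b] [c d] [-> ->].
congr #|pred_of_set _|; apply/setP=> -[i j]; apply/imsetP/idP=> [[[a b]]|Wij].
  by rewrite inE => ? [-> ->].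
by exists (j, i); rewrite ?inE.
Qed.

Lemma sub_slice W N i : W \subset N -> slice W i \subset slice N i.
Proof. by move=> /subsetP WN; apply/subsetP=> j; rewrite !inE => /WN. Qed.

Lemma transpose_nbhd e f W :
  transpose (nbhd (cartesian_product e f) W)
    = nbhd (cartesian_product f e) (transpose W).
Proof.
apply/setP=> -[j i]; rewrite mem_transpose; apply/nbhdP/nbhdP.
  case=> -[i' j'] Ww; rewrite /cartesian_product /= => H.
  by exists (j', i'); rewrite ?mem_transpose //= orbC andbC [X in _ || X]andbC.
case=> -[j' i'] Ww; rewrite /cartesian_product /= => H.
exists (i', j'); first by rewrite -mem_transpose.
by rewrite /= orbC andbC [X in _ || X]andbC.
Qed.

Lemma nbhd_slice e f W i :
  nbhd f (slice W i) \subset slice (nbhd (cartesian_product e f) W) i.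
Proof.
apply/subsetP=> j /nbhdP[j']; rewrite !inE => Wij' jj'; apply/exists_inP.
by exists (i, j') => //; rewrite /cartesian_product /= eqxx jj' orbT.
Qed.

Lemma nbhd_slice_col e f W i i' j :
  (i', j) \in W -> e i i' -> (i, j) \in nbhd (cartesian_product e f) W.
Proof.
move=> Wi'j ii'; apply: mem_nbhd Wi'j _.
by rewrite /cartesian_product /= ii' eqxx.
Qed.

Lemma nbhd_slice_row e f W i j j' :
  (i, j') \in W -> f j j' -> (i, j) \in nbhd (cartesian_product e f) W.
Proof.
move=> Wij' jj'; apply: mem_nbhd Wij' _.
by rewrite /cartesian_product /= jj' eqxx orbT.
Qed.

Lemma slice_excess W N (S : {set T}) :
  (forall i, #|slice W i| <= #|slice N i|) ->
  (forall i, i \in S -> #|slice W i| < #|slice N i|) ->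
  #|W| + #|S| <= #|N|.
Proof.
move=> leWN ltWN; rewrite !card_slices -sum1_card [X in _ + X]big_mkcond.
rewrite -big_split leq_sum //= => i _.
by case: ifP => [/ltWN|_]; rewrite ?addn1 ?addn0.
Qed.

(** This is [slice_excess] against the full product; it shows that large sets satisfy the threshold
    predicates. *)
Lemma slice_missing W :
  (forall i, slice W i != setT) -> #|W| + #|T| <= #|T| * #|U|.
Proof.
move=> miss; rewrite -card_prod -!cardsT.
have lt i : #|slice W i| < #|slice [set: T * U] i|.
  have -> : slice [set: T * U] i = setT by apply/setP=> j; rewrite !inE.
  by rewrite proper_card // properT.
by apply: slice_excess => [i|i _]; [apply: ltnW|].
Qed.

End Slices.

(** * Sets of vertices on a cycle *)

Section Cycle.
Variable n : nat.
Implicit Types W N P : {set 'I_n}.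

(** If nonempty, such a set is the whole cycle or, for even [n], possibly a parity class. *)
Definition shift2_stable P := [forall j in P, ordS (ordS j) \in P].

Definition has_shift2_orbit W :=
  [exists P : {set 'I_n}, [&& P != set0, P \subset W & shift2_stable P]].

Lemma cycle_graphE (i j : 'I_n) :
  cycle_graph i j = (ordS i == j) || (ordS j == i).
Proof. by []. Qed.

Lemma ordS_stable P (i : 'I_n) :
  i \in P -> (forall j, j \in P -> ordS j \in P) -> P = setT.
Proof.
move=> Pi PS; apply/setP=> j; rewrite inE.
have iterP t : iter t (@ordS n) i \in P by elim: t => //= t /PS.
have val_iter t : iter t (@ordS n) i = (i + t) %% n :> nat.
  elim: t => [|t /= ->]; first by rewrite addn0 modn_small.
  by rewrite -addn1 modnDml addn1 addnS.
(* From [i], [n - i] steps lead to 0 and [j] more to [j]. *)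
have <- : iter (n - i + j) (@ordS n) i = j; last exact: iterP.
apply: val_inj; rewrite /= val_iter addnA subnKC ?(ltnW (ltn_ord i)) //.
by rewrite modnDl modn_small.
Qed.

(** The union is closed under [ordS], since the shift by two returns to [P]. *)
Lemma shift2_stable_cover P j :
  P != set0 -> shift2_stable P -> j \in P :|: (@ordS n) @: P.
Proof.
case/set0Pn=> i Pi /forall_inP stP.
rewrite (@ordS_stable (P :|: (@ordS n) @: P) i) ?inE ?Pi // => {}j.
case/setUP=> [Pj|/imsetP[j' Pj' ->]]; rewrite inE; last by rewrite stP.
by rewrite imset_f ?orbT.
Qed.

(** Two sets of size [#|P|] cover the cycle; the half of [l] in the cylinder bound comes from
    here. *)
Lemma card_shift2_stable P : P != set0 -> shift2_stable P -> n <= #|P|.*2.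
Proof.
move=> nz st; rewrite -[n in n <= _]card_ord -cardsT -addnn.
rewrite -{2}(card_imset P (@ordS_inj n)) (leq_trans _ (leq_card_setU _ _)) //.
by apply/subset_leq_card/subsetP=> j _; apply: shift2_stable_cover.
Qed.

Lemma has_shift2_orbit0 : ~~ has_shift2_orbit set0.
Proof.
by apply/existsP=> -[P /and3P[nz]]; rewrite subset0 (negPf nz).
Qed.

Lemma has_shift2_orbitT : 0 < n -> has_shift2_orbit setT.
Proof.
move=> n_gt0; apply/existsP; exists setT; rewrite subsetT /=; apply/andP; split.
  by apply/set0Pn; exists (Ordinal n_gt0).
by apply/forall_inP=> j _; rewrite inE.
Qed.

Lemma shift2_orbit_other P j :
  2 < n -> P != set0 -> shift2_stable P -> exists2 j', j' \in P & j' != j.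
Proof.
move=> n_gt2 nz st; have := card_shift2_stable nz st.
case: (set_0Vmem (P :\ j)) => [E|[j']]; last first.
  by rewrite !inE => /andP[? ?]; exists j'.
by have := cardsD1 j P; rewrite E cards0; case: (j \in P) => -> /=; lia.
Qed.

(* Equality forces [W + 1 = N = W - 1], hence [W + 2 = W]. *)
Lemma cycle_nbhd_ltn W N :
  nbhd (@cycle_graph n) W \subset N -> N != set0 -> ~~ has_shift2_orbit W ->
  #|W| < #|N|.
Proof.
move=> WN nzN; apply: contraR; rewrite -leqNgt => leNW.
have succN : (@ordS n) @: W = N.
  apply/eqP; rewrite eqEcard (card_imset W (@ordS_inj n)) leNW andbT.
  apply/(subset_trans _ WN)/subsetP=> _ /imsetP[j Wj ->].
  by apply: mem_nbhd Wj _; rewrite cycle_graphE eqxx orbT.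
have predN : (@ord_pred n) @: W = N.
  apply/eqP; rewrite eqEcard (card_imset W (@ord_pred_inj n)) leNW andbT.
  apply/(subset_trans _ WN)/subsetP=> _ /imsetP[j Wj ->].
  by apply: mem_nbhd Wj _; rewrite cycle_graphE ord_predK eqxx.
apply/existsP; exists W; rewrite subxx; apply/andP; split.
  by apply: contraNneq nzN => W0; rewrite -succN W0 imset0.
apply/forall_inP=> j Wj.
have : ordS j \in N by rewrite -succN imset_f.
by rewrite -predN => /imsetP[j' Wj' ->]; rewrite ord_predK.
Qed.

End Cycle.

(** * Sets of vertices on a path that avoid a vertex *)

Section Path.
Variables (n : nat) (z : 'I_n).
Implicit Types (W N S : {set 'I_n}) (i r : 'I_n).

(** One step towards [z]. The default of [insubd] is never reached; the value at [z] itself is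
    meaningless. *)
Definition toward i : 'I_n := insubd i (if i < z then i.+1 else i.-1).

(* The distance from [r] to the endpoint of the path on its side of [z]. *)
Definition outer r : nat := if z < r then n.-1 - r else r.

Lemma val_toward i : toward i = (if i < z then i.+1 else i.-1) :> nat.
Proof.
rewrite val_insubd; have := ltn_ord i; have := ltn_ord z.
by case: (ltnP i z) => ? ? ?; case: ifP => //; lia.
Qed.

Lemma toward_adj i : i != z -> path_graph (toward i) i.
Proof.
by rewrite -val_eqE /path_graph val_toward /= => /eqP; case: ifP; lia.
Qed.

(** Away from [z], the shift can merge only the two neighbours of [z], and neither is in [W] because
    [z] is not in its neighbourhood. *)
Lemma toward_inj W :
  z \notin W -> z \notin nbhd (@path_graph n) W ->
  {in W &, injective toward}.
Proof.
move=> zW zN i j Wi Wj /(congr1 val) /=; rewrite !val_toward => Eij.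
have far w : w \in W -> [/\ w != z :> nat, w.+1 != z & z.+1 != w].
  move=> Ww; split.
  - by apply: contraNneq zW => /val_inj <-.
  - apply: contraNneq zN => Ew; apply: mem_nbhd Ww _.
    by rewrite /path_graph -Ew eqxx orbT.
  - apply: contraNneq zN => Ew; apply: mem_nbhd Ww _.
    by rewrite /path_graph -Ew eqxx.
apply: val_inj => /=; have [? ? ?] := far _ Wi; have [? ? ?] := far _ Wj.
by move: Eij; case: ifP; case: ifP; lia.
Qed.

Lemma toward_nbhd W :
  z \notin W -> toward @: W \subset nbhd (@path_graph n) W.
Proof.
move=> zW; apply/subsetP=> _ /imsetP[i Wi ->].
by apply: (mem_nbhd Wi); apply: toward_adj; apply: contraNneq zW => <-.
Qed.

Lemma path_nbhd_leq W N :
  nbhd (@path_graph n) W \subset N -> z \notin N -> z \notin W ->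
  #|W| <= #|N|.
Proof.
move=> WN zN zW; have zN' := contra (subsetP WN z) zN.
rewrite -(card_in_imset (toward_inj zW zN')).
exact/subset_leq_card/(subset_trans (toward_nbhd zW)).
Qed.

(* Equality forces [N = toward @: W].  Then from a vertex [r] of [N] at even
   distance from the end one steps outward by two, until an endpoint of the
   path is in [N]; but an endpoint is not of the form [toward w]. *)
Lemma path_nbhd_tight W N :
  nbhd (@path_graph n) W \subset N -> z \notin N -> z \notin W ->
  #|N| <= #|W| ->
  (forall r, r \in N -> odd (outer r)) /\
  (forall w, w \in W -> ~~ odd (outer w)).
Proof.
move=> WN zN zW leNW; have zN' := contra (subsetP WN z) zN.
have EN : toward @: W = N.
  apply/eqP; rewrite eqEcard (card_in_imset (toward_inj zW zN')) leNW andbT.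
  exact: subset_trans (toward_nbhd zW) WN.
have outer_toward w : w \in W -> outer (toward w) = (outer w).+1.
  move=> Ww; have Nw : toward w \in N by rewrite -EN imset_f.
  have : toward w != z by apply: contraNneq zN => <-.
  have : w != z by apply: contraNneq zW => <-.
  rewrite -!val_eqE /outer /= val_toward => /eqP ? /eqP.
  by have := ltn_ord w; case: ifP; case: ifP; case: ifP; lia.
have oddN d r : r \in N -> outer r = d -> odd d.
  elim/ltn_ind: d r => d IHd r; rewrite -EN => /imsetP[w Ww ->].
  rewrite outer_toward // => Ed; rewrite -Ed /=.
  case Ew: (outer w) => [|d'] //=; rewrite negbK.
  have w_neq_z : w != z by apply: contraNneq zW => <-.
  (* The neighbour of [w] away from [z], which exists as [outer w] is positive; its [outer] is two
     less than that of [toward w]. *)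
  pose v : 'I_n := insubd w (if z < w then w.+1 else w.-1).
  have Ev : v = (if z < w then w.+1 else w.-1) :> nat.
    rewrite val_insubd; move: Ew; rewrite /outer; have := ltn_ord w.
    by case: ifP => ? ? ?; case: ifP => //; lia.
  have outv : outer v = d'.
    move: Ew w_neq_z; rewrite -val_eqE /outer Ev /=; have := ltn_ord w.
    by case: ifP; case: ifP; lia.
  apply: (IHd d' _ v) => //; first by rewrite -Ed Ew.
  apply: (subsetP WN); apply: mem_nbhd Ww _; rewrite /path_graph Ev.
  by move: Ew; rewrite /outer; case: ifP; lia.
split=> [r Nr|w Ww]; first exact: oddN Nr _.
have := oddN _ (toward w).
by rewrite -EN imset_f // outer_toward // => /(_ _ isT erefl).
Qed.

End Path.

(** * Excess of rows that are cycles *)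

Definition has_row_orbit (T : finType) n (W : {set T * 'I_n}) :=
  [exists i, has_shift2_orbit (slice W i)].

Section CycleRows.
Variables (T : finType) (n : nat) (e : rel T).
Implicit Types W : {set T * 'I_n}.
Local Notation N := (nbhd (cartesian_product e (@cycle_graph n))).

Lemma has_row_orbit0 : ~~ has_row_orbit (set0 : {set T * 'I_n}).
Proof.
apply/existsP=> -[i]; apply/negP; suff -> : slice set0 i = set0 :> {set 'I_n}.
  exact: has_shift2_orbit0.
by apply/setP=> j; rewrite !inE.
Qed.

Lemma has_row_orbit_large W :
  0 < n -> #|T| * n < #|W| + #|T| -> has_row_orbit W.
Proof.
move=> n_gt0; apply: contraTT => no_orbit; rewrite -leqNgt.
have := @slice_missing _ _ W; rewrite card_ord; apply=> i.
apply: contraNneq no_orbit => Wi.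
by apply/existsP; exists i; rewrite Wi has_shift2_orbitT.
Qed.

Lemma cycle_rows_excess W :
  ~~ has_row_orbit W -> (forall i, slice (N W) i != set0) ->
  #|W| + #|T| <= #|N W|.
Proof.
move=> no_orbit hit; rewrite -cardsT.
have lt i : #|slice W i| < #|slice (N W) i|.
  apply: cycle_nbhd_ltn (nbhd_slice _ _ _ _) (hit i) _.
  by apply: contra no_orbit => ?; apply/existsP; exists i.
by apply: slice_excess => [i|i _]; [apply: ltnW|].
Qed.

(** A stable set that appears when [x] is added must pass through [x], so it lies in the row of
    [x]. *)
Lemma new_row_orbit W x :
  ~~ has_row_orbit W -> has_row_orbit (x |: W) ->
  exists P : {set 'I_n},
    [/\ P != set0, shift2_stable P, x.2 \in P
      & forall j, j \in P -> j != x.2 -> (x.1, j) \in W].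
Proof.
case: x => a b no_orbit /existsP[i /existsP[P /and3P[nz /subsetP PW st]]].
have inW j : j \in P -> (i, j) != (a, b) -> (i, j) \in W.
  by move=> /PW; rewrite !inE => /orP[->|].
have /subsetPn[c Pc nWc] : ~~ (P \subset slice W i).
  apply: contra no_orbit => PWi; apply/existsP; exists i.
  by apply/existsP; exists P; rewrite nz PWi.
have [Ei Ec] : i = a /\ c = b.
  move: nWc; rewrite inE; case: (eqVneq (i, c) (a, b)) => [[]|/inW->] //.
subst; exists P; split=> // j Pj neq_jb; apply: inW => //.
by rewrite xpair_eqE (negPf neq_jb) andbF.
Qed.

End CycleRows.

(** * The torus *)

(** The row orbit through [x] lies in or next to every column, so [N] meets all columns, and columns
    without orbits then give excess [l]. If [x] also completes a column orbit, use [W] instead of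
    [x |: W]: another point of that orbit replaces [x]. *)
Lemma torus_step k l (W : {set 'I_k * 'I_l}) x :
  2 < k -> 2 < l ->
  let N := nbhd (cartesian_product (@cycle_graph k) (@cycle_graph l)) in
  ~~ has_row_orbit W -> ~~ has_row_orbit (transpose W) ->
  has_row_orbit (x |: W) ->
  #|W| + l <= #|N W| \/ #|x |: W| + l <= #|N (x |: W)|.
Proof.
move=> k_gt2 l_gt2 N no_row no_col row.
have [P [nz st Pb inP]] := new_row_orbit no_row row.
have cover j : exists j', [/\ j' \in P & (j == j') || cycle_graph j j'].
  have /setUP[Pj|/imsetP[j' Pj' ->]] := shift2_stable_cover j nz st.
    by exists j; rewrite eqxx.
  by exists j'; rewrite cycle_graphE eqxx !orbT.
have excess V : ~~ has_row_orbit (transpose V) ->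
    (forall j, exists i, (i, j) \in N V) -> #|V| + l <= #|N V|.
  move=> no_orbit hit; rewrite -card_transpose -(card_transpose (N V)).
  rewrite transpose_nbhd.
  rewrite -[X in _ + X <= _]card_ord; apply: cycle_rows_excess => // j.
  have [i Nij] := hit j; apply/set0Pn; exists i.
  by rewrite -transpose_nbhd inE mem_transpose.
have hitP (V : {set 'I_k * 'I_l}) i j j' :
    (i, j') \in V -> (j == j') || cycle_graph j j' -> exists i, (i, j) \in N V.
  move=> Vij' /predU1P[->|jj'].
    exists (ordS i); apply: nbhd_slice_col Vij' _.
    by rewrite cycle_graphE eqxx orbT.
  by exists i; apply: nbhd_slice_row Vij' jj'.
have [col|no_col'] := boolP (has_row_orbit (transpose (x |: W))).
  left; rewrite transposeU1 in col.
  have [Q [nzQ stQ _ inQ]] := new_row_orbit no_col col.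
  have [i Qi /(inQ _ Qi)] := shift2_orbit_other x.1 k_gt2 nzQ stQ.
  rewrite mem_transpose => Wix; apply: excess => // j.
  have [j' [Pj' jj']] := cover j.
  have [Ej'|/(inP _ Pj') Wj'] := eqVneq j' x.2; last exact: hitP Wj' jj'.
  by apply: hitP Wix _; rewrite -Ej'.
right; apply: excess => // j; have [j' [Pj' jj']] := cover j.
apply: (hitP _ x.1 _ j') => //.
have [->|/(inP _ Pj') Wj'] := eqVneq j' x.2; last by rewrite inE Wj' orbT.
by rewrite -surjective_pairing setU11.
Qed.

Lemma grundy_torus k l : 2 < k -> 2 < l ->
  grundy_total_domination (cartesian_product (@cycle_graph k) (@cycle_graph l))
    <= k * l - minn k l.
Proof.
move=> k_gt2 l_gt2.
apply: (@grundy_total_domination_le _ _ _ _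
  [pred W | has_row_orbit W || has_row_orbit (transpose W)]) => /=.
- by rewrite card_prod !card_ord.
- by rewrite transpose0 negb_or !has_row_orbit0.
- move=> W big; apply/orP; left.
  apply: has_row_orbit_large; rewrite ?card_ord; first lia.
  by apply: leq_trans big _; rewrite leq_add2l geq_minl.
- move=> W x nWx; rewrite negb_or => /andP[no_row no_col] step.
  case/orP: step => [row|].
    by case: (torus_step k_gt2 l_gt2 no_row no_col row) => le; [left | right];
      apply: leq_trans le; rewrite leq_add2l geq_minr.
  (* A new column orbit is a new row orbit of the transpose. *)
  rewrite transposeU1 => col; rewrite -[W]transposeK in no_row.
  case: (torus_step l_gt2 k_gt2 no_col no_row col) => le; [left | right];
    move: le; rewrite -?transposeU1 -transpose_nbhd !card_transpose => le;
    by apply: leq_trans le; rewrite leq_add2l geq_minl.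
Qed.

(** * Columns that are paths, when [N W] misses a row *)

Section PathColumns.
Variables (k : nat) (U : finType) (f : rel U) (W : {set 'I_k * U}) (z : 'I_k).
Local Notation N := (nbhd (cartesian_product (@path_graph k) f)).
Hypothesis missed : slice (N W) z = set0.
Hypothesis f_total : forall j, exists j', f j' j.

Lemma missed_nbhd j : (z, j) \notin N W.
Proof. by have /setP/(_ j) := missed; rewrite !inE => ->. Qed.

(** A vertex of [W] in row [z] would put its neighbours within that row into [N W]. *)
Lemma missed_mem j : (z, j) \notin W.
Proof.
have [j' j'j] := f_total j; apply: contra (missed_nbhd j') => Wzj.
exact: nbhd_slice_row Wzj j'j.
Qed.

Lemma column_leq j : #|slice (transpose W) j| <= #|slice (transpose (N W)) j|.
Proof.
apply: (@path_nbhd_leq _ z); last by rewrite !inE missed_mem.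
  by rewrite transpose_nbhd nbhd_slice.
by rewrite inE mem_transpose missed_nbhd.
Qed.

Lemma column_tight j :
  #|slice (transpose (N W)) j| <= #|slice (transpose W) j| ->
  (forall i, (i, j) \in N W -> odd (outer z i)) /\
  (forall i, (i, j) \in W -> ~~ odd (outer z i)).
Proof.
have WN : nbhd (@path_graph k) (slice (transpose W) j)
    \subset slice (transpose (N W)) j by rewrite transpose_nbhd nbhd_slice.
have zN : z \notin slice (transpose (N W)) j.
  by rewrite inE mem_transpose missed_nbhd.
have zW : z \notin slice (transpose W) j by rewrite !inE missed_mem.
case/(path_nbhd_tight WN zN zW) => oddN evenW.
by split=> i; [have := oddN i | have := evenW i]; rewrite inE mem_transpose.
Qed.

End PathColumns.

Lemma cycle_graph_total n (j : 'I_n) : exists j', cycle_graph j' j.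
Proof. by exists (ordS j); rewrite cycle_graphE eqxx orbT. Qed.

Lemma path_graph_total n (j : 'I_n) : 1 < n -> exists j', path_graph j' j.
Proof.
move=> n_gt1; have ltj := ltn_ord j.
have [lt_j1n|ge] := ltnP j.+1 n.
  by exists (Ordinal lt_j1n); rewrite /path_graph /= eqxx orbT.
have lt' : j.-1 < n by lia.
exists (Ordinal lt'); rewrite /path_graph /=; lia.
Qed.

(** * The cylinder *)

(** If [N (x |: W)] misses a row, all columns have nonnegative excess, and at least half of them
    positive excess. Otherwise [N W] already meets every row, and the rows of [W] give excess
    [k]. *)
Lemma cylinder_step k l (W : {set 'I_k * 'I_l}) x :
  2 < l -> x \notin W ->
  let N := nbhd (cartesian_product (@path_graph k) (@cycle_graph l)) in
  ~~ has_row_orbit W -> has_row_orbit (x |: W) ->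
  #|W| + k <= #|N W| \/ #|x |: W| + (l + 1) %/ 2 <= #|N (x |: W)|.
Proof.
move=> l_gt2 nWx N no_row row.
have [P [nz st Pb inP]] := new_row_orbit no_row row.
have xP j : j \in P -> (x.1, j) \in x |: W.
  move=> Pj; have [->|/(inP _ Pj) Wj] := eqVneq j x.2.
    by rewrite -surjective_pairing setU11.
  by rewrite inE Wj orbT.
have [/existsP[z /eqP missed]|/existsPn hit] :=
    boolP [exists z, slice (N (x |: W)) z == set0].
  right.
  have leC := column_leq missed (@cycle_graph_total l).
  have tight := column_tight missed (@cycle_graph_total l).
  have leP (S : {set 'I_l}) : #|S| = #|P| ->
      (forall j, j \in S -> #|slice (transpose (x |: W)) j|
                   < #|slice (transpose (N (x |: W))) j|) ->
      #|x |: W| + (l + 1) %/ 2 <= #|N (x |: W)|.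
    move=> cS /(slice_excess leC); rewrite !card_transpose cS => le.
    apply: leq_trans le; rewrite leq_add2l.
    have := card_shift2_stable nz st; lia.
  (* In a tight column the set has even [outer] and its neighbourhood odd [outer]. So the columns of
     [P] are not tight if the row of [x] is odd, and those of its shift by one if it is even. *)
  have [odd_x|even_x] := boolP (odd (outer z x.1)).
    apply: (leP P) => // j Pj; rewrite ltnNge; apply/negP=> /tight[_ evenW].
    by have := evenW _ (xP _ Pj); rewrite odd_x.
  apply: (leP ((@ordS l) @: P)); first by rewrite (card_imset _ (@ordS_inj l)).
  move=> _ /imsetP[j Pj ->]; rewrite ltnNge; apply/negP=> /tight[oddN _].
  suff /oddN : (x.1, ordS j) \in N (x |: W) by rewrite (negPf even_x).
  apply: nbhd_slice_row (xP _ Pj) _.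
  by rewrite cycle_graphE eqxx orbT.
left; rewrite -[X in _ + X <= _]card_ord; apply: cycle_rows_excess => // i.
(* This second orbit point, already in [W], makes [N W] meet the same rows as the neighbours of
   [x]. *)
have [j Pj /(inP _ Pj) Wj] := shift2_orbit_other x.2 l_gt2 nz st.
have /set0Pn[c] := hit i; rewrite inE => /nbhdP[w].
case/setU1P=> [->|Ww] iw; last first.
  by apply/set0Pn; exists c; rewrite inE; apply: mem_nbhd Ww iw.
apply/set0Pn; case/orP: iw => /andP[] /=.
  by move=> ix _; exists j; rewrite inE; apply: nbhd_slice_col Wj ix.
move=> /eqP-> _; exists (ordS j); rewrite inE; apply: nbhd_slice_row Wj _.
by rewrite cycle_graphE eqxx orbT.
Qed.

Lemma grundy_cylinder k l : 2 < l ->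
  grundy_total_domination (cartesian_product (@path_graph k) (@cycle_graph l))
    <= k * l - minn k ((l + 1) %/ 2).
Proof.
move=> l_gt2.
apply: (@grundy_total_domination_le _ _ _ _ (@has_row_orbit _ _)).
- by rewrite card_prod !card_ord.
- exact: has_row_orbit0.
- move=> W big.
  apply: has_row_orbit_large; rewrite ?card_ord; first lia.
  by apply: leq_trans big _; rewrite leq_add2l geq_minl.
- move=> W x nWx no_row row.
  case: (cylinder_step l_gt2 nWx no_row row) => le; [left | right];
    apply: leq_trans le; rewrite leq_add2l.
    exact: geq_minl.
  exact: geq_minr.
Qed.

(** * The grid *)

Definition all_rows_hit (T U : finType) (e : rel T) (f : rel U)
    (W : {set T * U}) :=
  [forall i, slice (nbhd (cartesian_product e f) W) i != set0].

(* If a row met by [N W] has no excess, then the rows next to it are met by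
   [N W] and have positive excess, by the parities of [path_nbhd_tight]; so
   moving towards a missed row maps the tight rows injectively to the others.
   Finally [x] adds to [N W] a vertex in each row that [N W] missed. *)
Lemma grid_step k l (W : {set 'I_k * 'I_l}) x :
  1 < k -> x \notin W ->
  let e := @path_graph k in let f := @path_graph l in
  let N := nbhd (cartesian_product e f) in
  ~~ all_rows_hit e f W -> ~~ all_rows_hit f e (transpose W) ->
  all_rows_hit e f (x |: W) ->
  #|x |: W| + k %/ 2 <= #|N (x |: W)|.
Proof.
move=> k_gt1 nWx e f N /forallPn[z] /negPn/eqP missedz.
move=> /forallPn[y] /negPn/eqP missedy.
move=> /forallP hit.
have tot (i : 'I_k) : exists i', path_graph i' i by apply: path_graph_total.
(* The missed column [y] controls the excess of the rows, by transposition. *)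
have leR := column_leq missedy tot.
have tightR := column_tight missedy tot.
rewrite -transpose_nbhd !transposeK -/N in leR tightR.
pose M := [set i | slice (N W) i == set0].
pose tight i := #|slice (N W) i| <= #|slice W i|.
pose B := [set i | (i \notin M) && tight i].
pose G := [set i | (i \notin M) && ~~ tight i].
have cardBGM : #|B| + #|G| + #|M| = k.
  rewrite -[RHS]card_ord -(cardsC M) addnC; congr (_ + _).
  rewrite -(cardsID [set i | tight i] (~: M)); congr (_ + _).
    by apply: eq_card => i; rewrite !inE.
  by apply: eq_card => i; rewrite !inE andbC.
(* Row [i] has a point of [W], in a column [c] of even [outer]. Then [(i', c)] is in [N W], which is
   impossible if row [i'] is tight. *)
have BG i i' : i \in B -> e i' i -> i' \in G.
  rewrite !inE => /andP[hit_i tight_i] i'i.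
  have : 0 < #|slice W i| by apply: leq_trans tight_i; rewrite card_gt0.
  rewrite card_gt0 => /set0Pn[c]; rewrite inE => Wic.
  have Nc : (i', c) \in N W by apply: nbhd_slice_col Wic i'i.
  apply/andP; split; first by apply/set0Pn; exists c; rewrite inE.
  apply/negP=> /tightR[oddN _].
  have [_ /(_ c)] := tightR i tight_i; rewrite mem_transpose => /(_ Wic).
  by rewrite oddN // mem_transpose.
have Mz : z \in M by rewrite inE -missedz.
have zB : z \notin B by rewrite inE Mz.
have leBG : #|B| <= #|G|.
  rewrite -(card_in_imset (@toward_inj _ z B zB _)).
    apply/subset_leq_card/subsetP=> _ /imsetP[i Bi ->].
    by apply: (BG _ _ Bi); apply: toward_adj; apply: contraNneq zB => <-.
  by apply/nbhdP=> -[i Bi /(BG _ _ Bi)]; rewrite inE Mz.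
have exG : #|W| + #|G| <= #|N W|.
  apply: slice_excess => i; first exact: leR.
  by rewrite inE -ltnNge => /andP[].
have exM : #|N W| + #|M| <= #|N (x |: W)|.
  have sub : N W \subset N (x |: W) by apply/nbhdS/subsetUr.
  apply: slice_excess => i; first exact/subset_leq_card/sub_slice.
  by rewrite inE => /eqP->; rewrite cards0 card_gt0; apply: hit.
(* From [2|G| + |M| >= k] and [|M| >= 1] follows [|G| + |M| >= k %/ 2 + 1]; the extra 1 pays for
   [x]. *)
have M_gt0 : 0 < #|M| by rewrite card_gt0; apply/set0Pn; exists z.
by rewrite cardsU1 nWx; lia.
Qed.

(** A row missed by [N W] is also missed by [W], so every column lacks a vertex. *)
Lemma all_rows_hit_large k l (W : {set 'I_k * 'I_l}) :
  0 < k -> 1 < l -> k * l < #|W| + l ->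
  all_rows_hit (@path_graph k) (@path_graph l) W.
Proof.
move=> k_gt0 l_gt1; apply: contraTT => /forallPn[z] /negPn/eqP missed.
rewrite -leqNgt mulnC.
have := @slice_missing _ _ (transpose W).
rewrite card_transpose !card_ord; apply.
move=> j; apply/negP=> /eqP/setP/(_ z); rewrite inE mem_transpose inE => Wzj.
have tot (j' : 'I_l) : exists i, path_graph i j' by apply: path_graph_total.
by have := missed_mem missed tot j; rewrite Wzj.
Qed.

Lemma grundy_grid k l : 1 < k -> 1 < l ->
  grundy_total_domination (cartesian_product (@path_graph k) (@path_graph l))
    <= k * l - minn (k %/ 2) (l %/ 2).
Proof.
move=> k_gt1 l_gt1.
set e := @path_graph k; set f := @path_graph l.
have no_hit0 n1 n2 (e1 : rel 'I_n1.+1) (e2 : rel 'I_n2) :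
    ~~ all_rows_hit e1 e2 set0.
  apply/forallPn; exists ord0; apply/negPn/eqP/setP=> j.
  by rewrite nbhd0 !inE.
apply: (@grundy_total_domination_le _ _ _ _
  [pred W | all_rows_hit e f W || all_rows_hit f e (transpose W)]) => /=.
- by rewrite card_prod !card_ord.
- case: k k_gt1 e => // k _ e; case: l l_gt1 @f => // l _ f.
  by rewrite transpose0 negb_or !no_hit0.
- move=> W big; apply/orP; left.
  apply: all_rows_hit_large; [exact: ltnW | by [] | apply: leq_trans big _].
  by rewrite leq_add2l; lia.
(* Here the excess is always found after adding [x]; columns are treated by transposing. *)
- move=> W x nWx; rewrite negb_or => /andP[no_row no_col] step; right.
  case/orP: step => [row|].
    by apply: leq_trans (grid_step k_gt1 nWx no_row no_col row);
      rewrite leq_add2l geq_minl.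
  rewrite transposeU1 => col; rewrite -[W]transposeK in no_row.
  have nWx' : (x.2, x.1) \notin transpose W.
    by rewrite mem_transpose -surjective_pairing.
  have := grid_step l_gt1 nWx' no_col no_row col.
  rewrite -transposeU1 -transpose_nbhd !card_transpose => le.
  by apply: leq_trans le; rewrite leq_add2l geq_minr.
Qed.

Theorem theorem5p1 (k l : nat) (hk : 3 <= k) (hl : 3 <= l) :
  [/\ grundy_total_domination
        (cartesian_product (@cycle_graph k) (@cycle_graph l))
        <= k * l - minn k l,
      grundy_total_domination
        (cartesian_product (@path_graph k) (@path_graph l))
        <= k * l - minn (k %/ 2) (l %/ 2)
    & grundy_total_domination
        (cartesian_product (@path_graph k) (@cycle_graph l))
        <= k * l - minn k ((l + 1) %/ 2)].
Proof.
split; [exact: grundy_torus | | exact: grundy_cylinder].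
by apply: grundy_grid; apply: ltnW.
Qed.
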